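(* Let $K$ be a field, $S=K[x_1,\ldots,x_n]$ with $n>1$, and let $I_{\mathbf a,n,d}\subset S$ be a Veronese type ideal, where $d\geq 0$ is an integer, $\mathbf a=(a_1,\ldots,a_n)$ is an integer vector with $a_1\geq a_2\geq\cdots\geq a_n\geq 0$, and $\sum_{i=1}^n a_i\geq d$. Write $\sum_{i=1}^{n}a_i-d=s(n-1)$ with $s\in\mathbb Q$, and let $t=\min\{s,a_n,d\}$. Let $k$ be a positive integer. (a) If $t=s$, then $\operatorname{sat}((I_{\mathbf a,n,d})^k)=p_ik+q_i$, where $i\in\{0,\ldots,n-2\}$ is determined by $k\equiv i \pmod{n-1}$, $p_i=s$ and $q_i=\lfloor si\rfloor-si$. (b) If $t=a_n$, then $\operatorname{sat}((I_{\mathbf a,n,d})^k)=a_nk$. (c) If $t=d$, then $\operatorname{sat}((I_{\mathbf a,n,d})^k)=dk$.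
   Context: $\mathfrak m=(x_1,\ldots,x_n)$. The Veronese type ideal $I_{\mathbf a,n,d}\subset S$ is the monomial ideal generated by all monomials $x_1^{b_1}\cdots x_n^{b_n}$ with integers $b_i\geq 0$, $\sum_{i=1}^n b_i=d$ and $b_i\leq a_i$ for $i=1,\ldots,n$. The saturation number of a graded ideal $I$ is $\operatorname{sat}(I)=\min\{k\ge 0: I:\mathfrak m^k=I:\mathfrak m^{k+1}\}$. *)

(* Defs.v *)
From HB Require Import structures.
From mathcomp Require Import all_boot all_order all_algebra.
From mathcomp Require Import mpoly.

Set Implicit Arguments.
Unset Strict Implicit.
Unset Printing Implicit Defensive.

Import Order.TTheory GRing.Theory Num.Theory.

Local Open Scope ring_scope.

(* Ideals of a commutative ring are represented by their (Prop-valued)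
   membership predicates and compared extensionally. *)
Section Ideals.
Variable S : comNzRingType.
Implicit Types (G I J : S -> Prop) (f g : S).

Definition ideal_eq I J : Prop := forall f, I f <-> J f.

Definition ideal_gen G : S -> Prop := fun f =>
  exists (r : nat) (c g : 'I_r -> S),
    (forall i, G (g i)) /\ f = \sum_(i < r) c i * g i.

Definition ideal_mul I J : S -> Prop :=
  ideal_gen (fun h => exists f g, [/\ I f, J g & h = f * g]).

Fixpoint ideal_pow I (k : nat) : S -> Prop :=
  if k is k'.+1 then ideal_mul I (ideal_pow I k') else fun=> True.

Definition ideal_colon I J : S -> Prop := fun f => forall g, J g -> I (f * g).

End Ideals.

Definition mmax (K : fieldType) (n : nat) : {mpoly K[n]} -> Prop :=
  ideal_gen (fun f => exists i : 'I_n, f = 'X_i).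

Definition veronese (K : fieldType) (n : nat) (a : 'I_n -> nat) (d : nat) :
    {mpoly K[n]} -> Prop :=
  ideal_gen (fun f => exists b : 'X_{1..n},
    [/\ (\sum_(i < n) b i)%N = d, forall i, (b i <= a i)%N & f = 'X_[b]]).

(* [is_sat I v] means that sat(I) exists and equals v; being relational, it
   needs no convention for the minimum of an empty set. *)
Definition is_sat (K : fieldType) (n : nat) (I : {mpoly K[n]} -> Prop)
    (v : nat) : Prop :=
  let stable k := ideal_eq (ideal_colon I (ideal_pow (@mmax K n) k))
                           (ideal_colon I (ideal_pow (@mmax K n) k.+1)) in
  stable v /\ forall k, stable k -> (v <= k)%N.

Lemma ord_last_subproof (n : nat) : (1 < n)%N -> (n.-1 < n)%N.
Proof. by case: n. Qed.

(* Variables are indexed from 0, so that x_n is the variable of index n - 1. *)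
Definition ord_last (n : nat) (hn : (1 < n)%N) : 'I_n :=
  Ordinal (ord_last_subproof hn).

(* Main.v *)
(* Every ideal involved is monomial, so it is described by the up-closed set of
   exponents it contains: [I^k] by [k d <= \sum_i min(m_i, k a_i)] (each such
   exponent splits off a bounded factor of degree [d]) and [m^j] by degree at
   least [j]. Hence [I^k] is again of Veronese type, for [k a] and [k d].
   For Veronese type ideals, multiplying by a monomial of degree [j] raises the
   capped degree [\sum_i min(m_i, a_i)] least when only the variable nearest to
   its cap is used, so [I : m^j] and [I : m^(j+1)] differ iff some exponent of
   degree [d - j - 1] stays at least [j + 1] below every cap; this happens iff
   [j + 1 <= min(s, a_n, d)], and therefore sat(I) is the floor of that minimum. *)
Require Import Defs.
From HB Require Import structures.
From mathcomp Require Import all_boot all_order all_algebra.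
From mathcomp Require Import zify ring lra.
From mathcomp Require Import mpoly.

Set Implicit Arguments.
Unset Strict Implicit.
Unset Printing Implicit Defensive.

Import Order.TTheory GRing.Theory Num.Theory.

Local Open Scope ring_scope.

(** * Closure properties of generated ideals *)

Section IdealGen.
Variables (S : comNzRingType) (G : S -> Prop).

Lemma ideal_gen_subset f : G f -> ideal_gen G f.
Proof.
by move=> Gf; exists 1%N, (fun=> 1), (fun=> f); split=> //; rewrite big_ord1 mul1r.
Qed.

Lemma ideal_gen0 : ideal_gen G 0.
Proof.
by exists 0%N, (fun=> 0), (fun=> 0); split=> [[]|] //; rewrite big_ord0.
Qed.

Lemma ideal_genD f1 f2 : ideal_gen G f1 -> ideal_gen G f2 -> ideal_gen G (f1 + f2).
Proof.
move=> [r1 [c1 [g1 [G1 ->]]]] [r2 [c2 [g2 [G2 ->]]]].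
pose glue (h1 : 'I_r1 -> S) (h2 : 'I_r2 -> S) i :=
  match split i with inl j => h1 j | inr j => h2 j end.
exists (r1 + r2)%N, (glue c1 c2), (glue g1 g2); split.
  by move=> i; rewrite /glue; case: (split i).
rewrite big_split_ord; congr (_ + _); apply: eq_bigr => i _; rewrite /glue.
  by rewrite -[lshift _ _]/(unsplit (inl i)) unsplitK.
by rewrite -[rshift _ _]/(unsplit (inr i)) unsplitK.
Qed.

Lemma ideal_genM c f : ideal_gen G f -> ideal_gen G (c * f).
Proof.
move=> [r [c' [g [Gg ->]]]]; exists r, (fun i => c * c' i), g; split=> //.
by rewrite mulr_sumr; apply: eq_bigr => i _; rewrite mulrA.
Qed.

End IdealGen.

(** * Dictionary between monomial ideals and sets of exponents *)

Section MonomialIdeals.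
Variables (K : fieldType) (n : nat).
Implicit Types (U V : 'X_{1..n} -> Prop) (I J : {mpoly K[n]} -> Prop).

(** This is an ideal only for up-closed [U], so closure is carried as a separate hypothesis. *)
Definition monomial_ideal U : {mpoly K[n]} -> Prop :=
  fun f => forall m, m \in msupp f -> U m.

Definition up_closed U := forall m v : 'X_{1..n}, U m -> U (m + v)%MM.

Lemma monomial_idealX U m : monomial_ideal U 'X_[m] <-> U m.
Proof.
split=> [|Um m']; first by apply; rewrite msuppX mem_seq1.
by rewrite msuppX mem_seq1 => /eqP ->.
Qed.

Lemma monomial_ideal0 U : monomial_ideal U 0.
Proof. by move=> m; rewrite msupp0. Qed.

Lemma monomial_idealD U f g :
  monomial_ideal U f -> monomial_ideal U g -> monomial_ideal U (f + g).
Proof.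
by move=> Uf Ug m /msuppD_le; rewrite mem_cat => /orP[/Uf | /Ug].
Qed.

Lemma monomial_idealM U c f :
  up_closed U -> monomial_ideal U f -> monomial_ideal U (c * f).
Proof.
move=> upU Uf m /msuppM_le/allpairsP[[m1 m2] /= [_ /Uf Um2 ->]].
by rewrite addmC; apply: upU.
Qed.

(** The generators need not be monomials, which lets products of ideals be treated too: it is enough
    that their supports lie in [U] and that each monomial of [U] is generated, since a polynomial is
    a combination of the monomials of its support. *)
Lemma ideal_gen_monomial (G : {mpoly K[n]} -> Prop) U :
    up_closed U -> (forall f, G f -> monomial_ideal U f) ->
    (forall m, U m -> ideal_gen G 'X_[m]) ->
  ideal_eq (ideal_gen G) (monomial_ideal U).
Proof.
move=> upU GU UG f; split.
  move=> [r [c [g [Gg ->]]]].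
  apply: (big_ind (monomial_ideal U)) => [||i _].
  - exact: monomial_ideal0.
  - exact: monomial_idealD.
  by apply: monomial_idealM upU _; apply: GU.
move=> Uf; rewrite (mpolyE f) big_seq.
apply: (big_ind (ideal_gen G)) => [||m /Uf Um].
- exact: ideal_gen0.
- exact: ideal_genD.
by rewrite -mul_mpolyC; apply: ideal_genM; apply: UG.
Qed.

Lemma ideal_mul_monomial I J U V :
    up_closed U -> up_closed V ->
    ideal_eq I (monomial_ideal U) -> ideal_eq J (monomial_ideal V) ->
  ideal_eq (ideal_mul I J)
    (monomial_ideal (fun m => exists m1 m2, [/\ U m1, V m2 & m = (m1 + m2)%MM])).
Proof.
move=> upU upV IU JV; apply: ideal_gen_monomial.
- move=> _ v [m1 [m2 [Um1 Vm2 ->]]]; exists m1, (m2 + v)%MM.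
  by split=> //; [apply: upV | rewrite addmA].
- move=> _ [f [g [/IU Uf /JV Vg ->]]] m /msuppM_le/allpairsP[[m1 m2] /= [m1f m2g ->]].
  by exists m1, m2; split=> //; [apply: Uf | apply: Vg].
move=> _ [m1 [m2 [Um1 Vm2 ->]]]; apply: ideal_gen_subset.
exists 'X_[m1], 'X_[m2]; split; last by rewrite mpolyXD.
  by apply/IU/monomial_idealX.
by apply/JV/monomial_idealX.
Qed.

(** Testing against the monomials of [J] suffices: multiplication by ['X_[v]] shifts the support by
    [v] without cancellation. *)
Lemma ideal_colon_monomial I J U V :
    up_closed U -> ideal_eq I (monomial_ideal U) -> ideal_eq J (monomial_ideal V) ->
  ideal_eq (ideal_colon I J)
    (monomial_ideal (fun m => forall v, V v -> U (m + v)%MM)).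
Proof.
move=> upU IU JV f; split=> [fIJ m mf v Vv | Uf g /JV Vg].
  have /fIJ/IU : J 'X_[v] by apply/JV/monomial_idealX.
  apply; rewrite addmC mcoeff_msupp mcoeffMX -mcoeff_msupp //.
by apply/IU => _ /msuppM_le/allpairsP[[m1 m2] /= [/Uf Um1 /Vg Vm2 ->]]; apply: Um1.
Qed.

Lemma monomial_ideal_ext U V :
  ideal_eq (monomial_ideal U) (monomial_ideal V) <-> (forall m, U m <-> V m).
Proof.
split=> [UV m | UV f]; last by split=> Uf m /Uf /UV.
by split=> /monomial_idealX /UV /monomial_idealX.
Qed.

Lemma ideal_eq_trans I1 I2 I3 : ideal_eq I1 I2 -> ideal_eq I2 I3 -> ideal_eq I1 I3.
Proof. by move=> h12 h23 f; rewrite h12. Qed.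

Lemma ideal_eq_sym I1 I2 : ideal_eq I1 I2 -> ideal_eq I2 I1.
Proof. by move=> h12 f; rewrite h12. Qed.

Lemma mmaxE : ideal_eq (@mmax K n) (monomial_ideal (fun m => (0 < mdeg m)%N)).
Proof.
apply: ideal_gen_monomial => [m v|_ [i ->] m|m].
- by rewrite mdegD => ?; apply: ltn_addr.
- by rewrite msuppX mem_seq1 => /eqP ->; rewrite mdeg1.
rewrite lt0n mdeg_eq0 => /eqP m_neq0.
have [i mi_gt0] : exists i, (0 < m i)%N.
  apply/existsP; apply: contraPT m_neq0; rewrite negb_exists => /forallP m0 h.
  by apply: h; apply/mnmP => i; rewrite mnm0E; apply/eqP; rewrite -leqn0 leqNgt m0.
have U_le_m : (U_(i) <= m)%MM.
  by apply/mnm_lepP => j; rewrite mnm1E; case: eqP => [<-|].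
rewrite -(submK U_le_m) mpolyXD; apply: ideal_genM; apply: ideal_gen_subset.
by exists i.
Qed.

End MonomialIdeals.

(** * Exponents between two bounds, and the capped degree *)

Lemma mnm_interpolation (n : nat) (l u : 'I_n -> nat) (d : nat) :
    (forall i, l i <= u i)%N -> (\sum_(i < n) l i <= d)%N -> (d <= \sum_(i < n) u i)%N ->
  exists b : 'X_{1..n}, (forall i, l i <= b i <= u i)%N /\ mdeg b = d.
Proof.
(* Here [e] is the degree missing from [l]; while it is positive, some coordinate of [l] lies
   strictly below [u] and can be raised by one. *)
move=> le_lu /subnKC; move: (d - _)%N => e; elim: e l le_lu => [|e IHe] l le_lu ld du.
  exists [multinom l i | i < n]; split=> [i|]; first by rewrite mnmE leqnn le_lu.
  by rewrite -ld addn0 mdegE; apply: eq_bigr => i _; rewrite mnmE.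
have [i lt_lu] : exists i, (l i < u i)%N.
  apply/existsP; apply: contraLR du; rewrite negb_exists => /forallP ge_lu.
  rewrite -ltnNge -ld addnS ltnS; apply: leq_trans (leq_addr _ _).
  by apply: leq_sum => i _; rewrite leqNgt ge_lu.
have [j|||b [lbu bd]] := IHe (fun j => l j + (j == i))%N.
- by case: eqP => [->|_]; rewrite ?addn1 ?addn0.
- have -> : (\sum_(j < n) (l j + (j == i)) = (\sum_(j < n) l j).+1)%N.
    rewrite big_split -[RHS]addn1 /=; congr (_ + _)%N.
    by rewrite (bigD1 i) //= eqxx big1 // => j /negPf ->.
  by rewrite addSnnS.
- by [].
by exists b; split=> // j; have /andP[lb ->] := lbu j; rewrite (leq_trans _ lb) ?leq_addr.
Qed.

Lemma sum_ord_const n c : (\sum_(i < n) c = n * c)%N.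
Proof. by rewrite sum_nat_const card_ord. Qed.

Definition cap_deg (n : nat) (a : 'I_n -> nat) (m : 'X_{1..n}) : nat :=
  (\sum_(i < n) minn (m i) (a i))%N.

Lemma up_closed_cap_deg n (a : 'I_n -> nat) d :
  up_closed (fun m => d <= cap_deg a m)%N.
Proof.
move=> m v /leq_trans; apply; apply: leq_sum => i _.
by rewrite mnmDE leq_min geq_minr geq_min leq_addr.
Qed.

Lemma up_closed_mdeg n d : up_closed (fun m : 'X_{1..n} => d <= mdeg m)%N.
Proof. by move=> m v; rewrite mdegD => /leq_trans; apply; apply: leq_addr. Qed.

(** * Exponent sets of the powers of both ideals *)

Section Powers.
Variables (K : fieldType) (n : nat).

(** Interpolating between 0 and the truncation of [m] at the caps gives a generator of degree [d]
    dividing ['X_[m]]. *)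
Lemma veroneseE (a : 'I_n -> nat) d :
  ideal_eq (@veronese K n a d) (monomial_ideal (fun m => d <= cap_deg a m)%N).
Proof.
apply: ideal_gen_monomial => [|_ [b [<- le_ba ->]] m|m].
- exact: up_closed_cap_deg.
- rewrite msuppX mem_seq1 => /eqP ->; apply: leq_sum => i _.
  by rewrite leq_min leqnn le_ba.
move=> dm; have [|b [bm bd]] := mnm_interpolation (fun i => leq0n _) _ dm.
  by rewrite big1.
have b_le_m : (b <= m)%MM.
  by apply/mnm_lepP => i; have := bm i; rewrite leq_min => /and3P[].
rewrite -(submK b_le_m) mpolyXD; apply: ideal_genM; apply: ideal_gen_subset.
exists b; split=> [|i|//]; first by rewrite -bd mdegE.
by have := bm i; rewrite leq_min => /and3P[].
Qed.

(* For [c <= m] of degree [(k + 1) d] with [c i <= (k + 1) a i], the bounds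
   [c i - k * a i <= b i <= minn (c i) (a i)] on the degree [d]
   factor [b] enclose [c i / (k + 1)], hence their sums enclose [d]. *)
Lemma cap_deg_split (a : 'I_n -> nat) d k (m : 'X_{1..n}) :
    (k.+1 * d <= cap_deg (fun i => k.+1 * a i) m)%N ->
  exists m1 m2 : 'X_{1..n}, [/\ (d <= cap_deg a m1)%N,
    (k * d <= cap_deg (fun i => k * a i) m2)%N & m = (m1 + m2)%MM].
Proof.
move=> dm; have [|c [cm cd]] := mnm_interpolation (fun i => leq0n _) _ dm.
  by rewrite big1.
have {}cm i : (c i <= m i)%N /\ (c i <= k.+1 * a i)%N.
  by have := cm i; rewrite leq_min => /and3P[].
have [i|||b [bc bd]] := @mnm_interpolation n (fun i => c i - k * a i)%N
                         (fun i => minn (c i) (a i)) d.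
- by have [_] := cm i; rewrite mulSn; lia.
- rewrite -(@leq_pmul2l k.+1) // -cd mdegE big_distrr /=.
  by apply: leq_sum => i _; have [_] := cm i; nia.
- rewrite -(@leq_pmul2l k.+1) // -cd mdegE big_distrr /=.
  by apply: leq_sum => i _; have [_] := cm i; rewrite /minn; case: ltnP; nia.
exists b, (m - b)%MM; split.
- rewrite -bd mdegE; apply: leq_sum => i _.
  by have := bc i; rewrite !leq_min leqnn => /and3P[].
- rewrite -(leq_add2l d) -mulSn -{2}bd -cd !mdegE -big_split /=.
  apply: leq_sum => i _; rewrite mnmBE.
  have [h1 h2] := cm i; have := bc i; lia.
rewrite addmC submK //; apply/mnm_lepP => i.
by have [h1 h2] := cm i; have := bc i; lia.
Qed.

Lemma veronese_powE (a : 'I_n -> nat) d k :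
  ideal_eq (ideal_pow (@veronese K n a d) k)
    (monomial_ideal (fun m => k * d <= cap_deg (fun i => k * a i) m)%N).
Proof.
elim: k => [|k IHk] /=; first by move=> f; split.
apply: ideal_eq_trans (ideal_mul_monomial _ _ (veroneseE a d) IHk) _.
1,2: exact: up_closed_cap_deg.
apply/monomial_ideal_ext => m; split=> [[m1 [m2 [dm1 dm2 ->]]]|].
  rewrite mulSn (leq_trans (leq_add dm1 dm2)) // -big_split leq_sum // => i _.
  by rewrite /= mnmDE mulSn; lia.
exact: cap_deg_split.
Qed.

Lemma mmax_powE k :
  ideal_eq (ideal_pow (@mmax K n) k) (monomial_ideal (fun m => k <= mdeg m)%N).
Proof.
elim: k => [|k IHk] /=; first by move=> f; split.
apply: ideal_eq_trans (ideal_mul_monomial _ _ (@mmaxE K n) IHk) _.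
1,2: exact: up_closed_mdeg.
apply/monomial_ideal_ext => m; split=> [[m1 [m2 [dm1 dm2 ->]]]|km].
  by rewrite mdegD -add1n leq_add.
have [i|||m1 [m1m m1d]] := @mnm_interpolation n (fun=> 0%N) m 1.
- by [].
- by rewrite big1.
- by rewrite -mdegE; apply: leq_trans km.
have m1_le_m : (m1 <= m)%MM by apply/mnm_lepP => i; have /andP[] := m1m i.
exists m1, (m - m1)%MM; split; rewrite ?m1d // 1?addmC ?submK //.
by move: km; rewrite -{1}(submK m1_le_m) mdegD m1d addn1.
Qed.

End Powers.

(** * Stability of the chain of colon ideals *)

Definition sat_stable (K : fieldType) (n : nat) (I : {mpoly K[n]} -> Prop) k :=
  ideal_eq (ideal_colon I (ideal_pow (@mmax K n) k))
           (ideal_colon I (ideal_pow (@mmax K n) k.+1)).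

Section Saturation.
Variables (K : fieldType) (n : nat) (a : 'I_n -> nat) (d : nat).
Variable I : {mpoly K[n]} -> Prop.
Hypothesis n_gt0 : (0 < n)%N.
Hypothesis IE : ideal_eq I (monomial_ideal (fun m => d <= cap_deg a m)%N).

(** Since the colon ideals increase with [k], only one inclusion is at stake. *)
Lemma sat_stable_monomial k : sat_stable I k <->
  forall m : 'X_{1..n},
    (forall v, k < mdeg v -> d <= cap_deg a (m + v)%MM)%N ->
    (forall v, k <= mdeg v -> d <= cap_deg a (m + v)%MM)%N.
Proof.
have colonE j := ideal_colon_monomial (@up_closed_cap_deg n a d) IE (@mmax_powE K n j).
split=> [st m Um|st].
  have /monomial_ideal_ext/(_ m) := ideal_eq_trans (ideal_eq_trans
    (ideal_eq_sym (colonE k)) st) (colonE k.+1).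
  by move=> [_]; apply.
apply: ideal_eq_trans (colonE k) (ideal_eq_trans _ (ideal_eq_sym (colonE k.+1))).
apply/monomial_ideal_ext => m; split=> [Um v kv|]; last exact: st.
by apply: Um; apply: ltnW.
Qed.

(* Any monomial of degree [d - k - 1] whose exponents stay at least [k + 1]
   below the caps [a i] lies in [I : m^(k+1)] but not in [I : m^k]. *)
Lemma sat_unstable k :
    (forall i, k < a i)%N -> (k < d)%N ->
    (d + n.-1 * k.+1 <= \sum_(i < n) a i)%N ->
  ~ sat_stable I k.
Proof.
move=> ka kd dna /sat_stable_monomial st.
have [i|||m [ma md]] := @mnm_interpolation n (fun=> 0%N) (fun i => a i - k.+1)%N (d - k.+1).
- by [].
- by rewrite big1.
- have : (\sum_(i < n) (a i - k.+1) + n * k.+1 = \sum_(i < n) a i)%N.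
    rewrite -sum_ord_const -big_split /=.
    by apply: eq_bigr => i _; rewrite subnK.
  move: dna; have -> : (n * k.+1 = k.+1 + n.-1 * k.+1)%N by rewrite -mulSn prednK.
  lia.
have m0k : (k <= mdeg (U_(Ordinal n_gt0) *+ k))%N by rewrite mdegMn mdeg1 mul1n.
have Um (v : 'X_{1..n}) : (k < mdeg v)%N -> (d <= cap_deg a (m + v))%N.
  (* If [m + v] reaches the cap of [i], its truncation dominates [m] plus [k.+1] copies of variable
     [i], which respects all caps and has degree [d]. If it reaches no cap, its capped degree is its
     degree, at least [d]. *)
  move=> kv; have [/existsP[i ai]|] := boolP [exists i, a i <= m i + v i]%N.
    have <- : mdeg (m + U_(i) *+ k.+1)%MM = d by rewrite mdegD mdegMn mdeg1 md; lia.
    rewrite mdegE; apply: leq_sum => j _; rewrite !mnmDE mulmnE mnm1E.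
    by case: eqP => [<-|_]; have /andP[_] := ma j; have := ka j; have := ka i;
      have /andP[_] := ma i; lia.
  rewrite negb_exists => /forallP lt_a.
  apply: leq_trans (_ : mdeg (m + v) <= _)%N; first by rewrite mdegD md; lia.
  rewrite mdegE; apply: leq_sum => i _.
  by rewrite leq_min leqnn mnmDE ltnW // ltnNge lt_a.
have := st m Um _ m0k; rewrite leqNgt => /negP; apply.
(* Adding only [k] copies of one variable leaves the total degree at [d - 1]. *)
apply: leq_ltn_trans (_ : mdeg (m + U_(Ordinal n_gt0) *+ k) < d)%N.
  by rewrite mdegE leq_sum // => i _; apply: geq_minl.
by rewrite mdegD mdegMn mdeg1 md; lia.
Qed.

Lemma sat_stableI k :
    ~ [/\ forall i, (k < a i)%N, (k < d)%N &
         (d + n.-1 * k.+1 <= \sum_(i < n) a i)%N] ->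
  sat_stable I k.
Proof.
move=> nK; apply/sat_stable_monomial => m Um v kv.
rewrite leqNgt; apply/negP => lt_d; apply: nK.
(* As [m + v] becomes a member after multiplication by any variable, it misses
   degree [d] by exactly one and each of its exponents lies below its cap. *)
have Uv i : (d <= cap_deg a (m + v + U_(i)))%N.
  by rewrite -addmA; apply: Um; rewrite mdegD mdeg1 addn1.
have gain i : (cap_deg a (m + v + U_(i)) =
               cap_deg a (m + v) + ((m + v)%MM i < a i))%N.
  rewrite /cap_deg (bigD1 i) //= [in RHS](bigD1 i) //= addnAC; congr (_ + _)%N.
    by rewrite [in LHS]mnmDE mnm1E eqxx; lia.
  apply: eq_bigr => j ji.
  by rewrite [in LHS]mnmDE mnm1E eq_sym (negPf ji) addn0.
have lt_a i : ((m + v)%MM i < a i)%N.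
  by have := Uv i; rewrite gain; case: (_ < a i)%N => //; lia.
have cap_mv : cap_deg a (m + v) = mdeg (m + v).
  by rewrite mdegE; apply: eq_bigr => i _; apply/minn_idPl/ltnW.
have mvd : (mdeg m + mdeg v).+1 = d.
  have := Uv (Ordinal n_gt0); rewrite gain lt_a -mdegD.
  by rewrite -cap_mv; lia.
(* Adding [k.+1] copies of variable [i] to [m] must gain at least [d - mdeg m], that is
   [(mdeg v).+1], but gains at most the smaller of [k.+1] and [a i - m i]. As [k <= mdeg v],
   equality [mdeg v = k] is forced and [m] lies [k.+1] below each cap. *)
have kU i : (mdeg v < k.+1 /\ m i + k.+1 <= a i)%N.
  have : (d <= cap_deg a (m + U_(i) *+ k.+1))%N.
    by apply: Um; rewrite mdegMn mdeg1 mul1n.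
  have : (cap_deg a (m + U_(i) *+ k.+1) + m i <= mdeg m + minn (m i + k.+1) (a i))%N.
    rewrite mdegE /cap_deg (bigD1 i) //= [in leqRHS](bigD1 i) //=.
    rewrite mnmDE mulmnE mnm1E eqxx mul1n.
    have : (\sum_(j < n | j != i) minn ((m + U_(i) *+ k.+1)%MM j) (a j)
            <= \sum_(j < n | j != i) m j)%N.
      apply: leq_sum => j ji.
      by rewrite mnmDE mulmnE mnm1E eq_sym (negPf ji) addn0 geq_minl.
    by move: (\sum_(j < n | j != i) minn _ _)%N (\sum_(j < n | j != i) m j)%N => x y; lia.
  have := lt_a i; rewrite mnmDE; lia.
have [vk _] := kU (Ordinal n_gt0).
split=> [i||]; first by have [_] := kU i; lia.
  by lia.
have : (mdeg m + n * k.+1 <= \sum_(i < n) a i)%N.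
  rewrite -sum_ord_const mdegE -big_split.
  by apply: leq_sum => i _; have [] := kU i.
have -> : (n * k.+1 = k.+1 + n.-1 * k.+1)%N by rewrite -mulSn prednK.
lia.
Qed.

Lemma is_satP v :
    (forall k, [/\ forall i, (k < a i)%N, (k < d)%N &
       (d + n.-1 * k.+1 <= \sum_(i < n) a i)%N] <-> (k < v)%N) ->
  is_sat I v.
Proof.
move=> kv; split=> [|k st]; first by apply: sat_stableI => /kv; rewrite ltnn.
by rewrite leqNgt; apply/negP => /kv[? ? ?]; apply: (@sat_unstable k).
Qed.

End Saturation.

(** * The saturation number as a floor, and its three cases *)

(** Passing to [k * a] and [k * d] scales [s], the last cap and the degree by [k], hence also their
    minimum; the two inequalities say that [v] is the floor of the result. The smallest cap is the
    last one, and dividing by [n - 1] turns the degree condition into a bound by [k * s]. *)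
Lemma veronese_pow_sat (K : fieldType) (n : nat) (hn : (1 < n)%N) (d : nat)
    (a : 'I_n -> nat) (s : rat) (k v : nat) :
    (forall i j : 'I_n, (i <= j)%N -> (a j <= a i)%N) ->
    (\sum_(i < n) a i)%N%:R - d%:R = s * (n%:R - 1) ->
    v%:R <= k%:R * Num.min s (Num.min (a (ord_last hn))%:R d%:R) < v.+1%:R ->
  is_sat (ideal_pow (@veronese K n a d) k) v.
Proof.
move=> ha hs /andP[le_v lt_v].
apply: (is_satP (ltnW hn) (@veronese_powE K n a d k)) => j.
have le_last i : (a (ord_last hn) <= a i)%N.
  by apply: ha; rewrite /= -ltnS (ltn_predK hn).
have n1 : (n.-1%:R : rat) = n%:R - 1 by rewrite -subn1 natrB // ltnW.
have n1_gt0 : (0 : rat) < n%:R - 1 by rewrite subr_gt0 ltr1n.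
have sumE : (k * d + n.-1 * j.+1 <= \sum_(i < n) k * a i)%N = (j.+1%:R <= k%:R * s).
  rewrite -big_distrr /= -(ler_nat rat) natrD !natrM n1.
  rewrite -[RHS](ler_pM2r n1_gt0) -[k%:R * s * _]mulrA -hs [k%:R * (_ - _)]mulrBr.
  by rewrite lerBrDl [j.+1%:R * _]mulrC.
have -> : (j < v)%N = (j.+1%:R <= k%:R * Num.min s (Num.min (a (ord_last hn))%:R d%:R)).
  apply/idP/idP => [jv|jv]; first by apply: le_trans le_v; rewrite ler_nat.
  by rewrite -ltnS -(ltr_nat rat); apply: le_lt_trans lt_v.
rewrite !minr_pMr // !le_min -!natrM !ler_nat sumE.
split=> [[ja -> ->]|/and3P[-> ja ->]]; first by rewrite ja.
by split=> // i; apply: leq_trans ja _; rewrite leq_mul2l le_last orbT.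
Qed.

Theorem theorem4p6 (K : fieldType) (n : nat) (hn : (1 < n)%N)
    (d : nat) (a : 'I_n -> nat)
    (ha : forall i j : 'I_n, (i <= j)%N -> (a j <= a i)%N)
    (hd : (d <= \sum_(i < n) a i)%N)
    (s t : rat)
    (hs : (\sum_(i < n) a i)%N%:R - d%:R = s * (n%:R - 1))
    (ht : t = Num.min s (Num.min (a (ord_last hn))%:R d%:R))
    (k : nat) (hk : (0 < k)%N) :
  [/\ (t = s ->
        forall i : nat, (i <= n - 2)%N -> k = i %[mod n - 1] ->
        let p : rat := s in
        let q : rat := (Num.floor (s * i%:R))%:~R - s * i%:R in
        exists v : nat, is_sat (ideal_pow (@veronese K n a d) k) v
                        /\ v%:R = p * k%:R + q),
      (t = (a (ord_last hn))%:R ->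
        is_sat (ideal_pow (@veronese K n a d) k) (a (ord_last hn) * k)%N)
    & (t = d%:R ->
        is_sat (ideal_pow (@veronese K n a d) k) (d * k)%N)].
Proof.
have n1_gt0 : (0 : rat) < n%:R - 1 by rewrite subr_gt0 ltr1n.
have s_ge0 : 0 <= s.
  by rewrite -(pmulr_lge0 _ n1_gt0) -hs subr_ge0 ler_nat.
split=> ts.
- move=> i le_i ki p q.
  have ks_ge0 : 0 <= k%:R * s by rewrite mulr_ge0.
  set v := Num.truncn (k%:R * s).
  have v_itv : v%:R <= k%:R * s < v.+1%:R by apply: truncn_itv.
  exists v; split.
    by apply: (veronese_pow_sat K ha hs); rewrite -ht ts.
  have [m km] : exists m, (k = m * (n - 1) + i)%N.
    exists (k %/ (n - 1))%N; rewrite {1}(divn_eq k (n - 1)) ki modn_small //; lia.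
  (* As [s * (n - 1)] is an integer, [k * s] and [s * i] differ by the integer [N], so the floor of
     [s * i] is [v - N]. *)
  pose N := (m * (\sum_(j < n) a j - d))%N.
  have ksE : k%:R * s = s * i%:R + N%:R.
    by rewrite km natrD !natrM (natrB _ hd) (natrB _ (ltnW hn)) hs; ring.
  have vN : (v%:Z - N%:Z)%:~R = v%:R - N%:R :> rat by rewrite rmorphB.
  rewrite /q (@floor_def _ _ (v%:Z - N%:Z)) ?vN /p.
    by rewrite mulrC ksE; ring.
  by rewrite intrD vN; move: v_itv; rewrite ksE -natr1; lra.
- by apply: (veronese_pow_sat K ha hs); rewrite -ht ts -natrM mulnC !ltr_nat lexx ltnS leqnn.
by apply: (veronese_pow_sat K ha hs); rewrite -ht ts -natrM mulnC !ltr_nat lexx ltnS leqnn.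
Qed.
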